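(* Let $G$ be a metacyclic Frobenius group with Frobenius kernel $N$; for $K \leqslant G$ write $N_K := K\cap N$. Let $\mathcal{R}$ be a categorical transfer system on $\mathrm{Sub}(G)/G$. Then $\mathcal{R}$ is liftable if and only if whenever $[K]\,\mathcal{R}\,[H]$ with $N_K\neq N_H$, we have $[N_K]\,\mathcal{R}\,[H]$ (or equivalently $[N_K]\,\mathcal{R}\,[K]$).
   Context: Write ${}^gH := gHg^{-1}$. A finite group $G$ is a Frobenius group if it has a proper nontrivial subgroup $T$ (a Frobenius complement) such that $T\cap {}^gT$ is trivial for every $g\in G\setminus T$; its Frobenius kernel $N$ consists of the identity together with the elements of $G\setminus\bigcup_{g\in G}{}^gT$, and is a normal subgroup. A metacyclic Frobenius group is a (finite) Frobenius group such that both the kernel $N$ and the complement $T$ are cyclic; then $G=N\rtimes T$. $\mathrm{Sub}(G)$ is the poset of subgroups of $G$, $[H]$ is the conjugacy class of $H\leqslant G$, and $\mathrm{Sub}(G)/G$ is the poset of conjugacy classes of subgroups, with $[K]\leqslant[H]$ iff some conjugate of $K$ is contained in $H$. A $G$-transfer system is a relation $\mathcal{R}$ on $\mathrm{Sub}(G)$ refining inclusion ($K\,\mathcal{R}\,H$ implies $K \leqslant H$) which is reflexive, transitive, closed under conjugation ($K\,\mathcal{R}\,H$ implies ${}^gK\,\mathcal{R}\,{}^gH$ for all $g\in G$) and closed under restriction ($K\,\mathcal{R}\,H$ and $L \leqslant H$ imply $(K\cap L)\,\mathcal{R}\,L$). A categorical transfer system on a poset $(\mathcal{P},\leqslant)$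 is a partial order $\mathcal{R}$ on $\mathcal{P}$ refining $\leqslant$ such that whenever $x\,\mathcal{R}\,y$ and $z \leqslant y$, then for every maximal element $w$ of $x^{\downarrow}\cap z^{\downarrow}$ we have $w\,\mathcal{R}\,z$, where $x^{\downarrow}=\{y : y \leqslant x\}$. For a categorical transfer system $\mathcal{R}$ on $\mathrm{Sub}(G)/G$, $\pi^{-1}(\mathcal{R})$ is the relation on $\mathrm{Sub}(G)$ consisting of the pairs $(K,H)$ with $K \leqslant H$ and $[K]\,\mathcal{R}\,[H]$, and $\pi^*(\mathcal{R})$ is the smallest $G$-transfer system containing $\pi^{-1}(\mathcal{R})$. For a $G$-transfer system $\mathcal{R}$, $\pi_*(\mathcal{R})$ is the relation on $\mathrm{Sub}(G)/G$ in which $[K]$ is related to $[H]$ iff there exist $K'\leqslant H'$ with $[K']=[K]$, $[H']=[H]$ and $K'\,\mathcal{R}\,H'$. A categorical transfer system $\mathcal{R}$ on $\mathrm{Sub}(G)/G$ is liftable if $\mathcal{R}=\pi_*(\pi^*(\mathcal{R}))$. *)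

(* Defs.v *)
From HB Require Import structures.
From mathcomp Require Import all_boot all_order all_fingroup all_solvable.

Set Implicit Arguments.
Unset Strict Implicit.
Unset Printing Implicit Defensive.

Import Order.TTheory.
Local Open Scope group_scope.

Section MetacyclicFrobenius.

Variable gT : finGroupType.

(* The library predicate [Frobenius G = N ><| T] includes N ><| T = G;
   Frobenius_kernelE below recovers the description of the kernel N as the
   identity together with the elements lying in no conjugate of T. *)
Definition metacyclic_Frobenius (G N : {group gT}) : bool :=
  [exists T : {group gT}, [&& [Frobenius G = N ><| T], cyclic N & cyclic T]].

Lemma Frobenius_kernelE (G N T : {group gT}) :
  [Frobenius G = N ><| T] ->
  N = 1 |: (G :\: \bigcup_(g in G) T :^ g) :> {set gT}.
Proof.
move=> frobG; have [defG _ ntT _ _] := Frobenius_context frobG.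
have [/andP[sNG _] sTG mulNT _ tiNT] := sdprod_context defG.
have /and3P[/eqP covG _ _] := Frobenius_partition frobG.
apply/setP=> x; rewrite !inE; have [->|ntx] := eqVneq x 1; first by rewrite group1.
apply/idP/andP=> /= [Nx | [notTx Gx]].
  split; last exact: subsetP sNG _ Nx.
  apply/bigcupP=> -[g Gg]; rewrite mem_conjg => Txg.
  have nNG: G \subset 'N(N) by case/sdprod_context: defG => /andP[].
  have: x ^ g^-1 \in N :&: T.
    by rewrite inE Txg memJ_norm ?Nx // groupV (subsetP nNG).
  by rewrite tiNT inE conjg_eq1 (negPf ntx).
have: x \in cover (gval N |: (T^# :^: N)) by rewrite covG.
case/bigcupP=> A /setU1P[-> // | /imsetP[g Ng ->]].
rewrite conjD1g => /setD1P[_ Tgx]; case/negP: notTx.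
by apply/bigcupP; exists g => //; apply: subsetP sNG _ Ng.
Qed.

End MetacyclicFrobenius.

(* The whole type gT plays the role of the group G: Sub(G) is {group gT}
   ordered by \subset, and Sub(G)/G is the type of orbits of the conjugation
   action 'JG of [set: gT] on {group gT}. As H :^ g is g^-1 H g, the conjugate
   g H g^-1 is H :^ g^-1; all conditions below quantify over every g. *)
Section SubgroupClasses.

Variable gT : finGroupType.
Implicit Types (K H L : {group gT}).

Record subclass := Subclass {
  subclass_set :> {set {group gT}};
  _ : subclass_set \in orbit 'JG [set: gT] @: [set: {group gT}]
}.

HB.instance Definition _ := [isSub for subclass_set].
HB.instance Definition _ := [Choice of subclass by <:].

Definition class_of (H : {group gT}) : subclass :=
  Subclass (imset_f (orbit 'JG [set: gT]) (in_setT H)).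

Lemma class_of_eqP K H :
  reflect (exists g, H = (K :^ g)%G) (class_of K == class_of H).
Proof.
rewrite eq_sym; apply: (iffP eqP) => [/(congr1 subclass_set) /= eqKH | [g ->]].
  by case/orbitP: (introT orbit_eqP eqKH) => g _ <-; exists g.
by apply/val_inj/orbit_eqP/mem_orbit; rewrite inE.
Qed.

Lemma class_of_surj (C : subclass) : exists H, C = class_of H.
Proof.
case: C => C PC; have /imsetP[H _ defC] := PC.
by exists H; apply: val_inj.
Qed.

Definition subclass_le (C D : subclass) : bool :=
  [exists K in subclass_set C, [exists H in subclass_set D, K \subset H]].

Lemma subclass_leP K H :
  reflect (exists g, K :^ g \subset H) (subclass_le (class_of K) (class_of H)).
Proof.
apply: (iffP exists_inP) => [[_ /orbitP[g _ <-]] | [g sKgH]].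
  case/exists_inP=> _ /orbitP[h _ <-] /= sKH.
  by exists (g * h^-1); rewrite conjsgM sub_conjgV.
exists (K :^ g)%G; first by apply: mem_orbit; rewrite inE.
by apply/exists_inP; exists H => //; apply: orbit_refl.
Qed.

Lemma subclass_le_refl : reflexive subclass_le.
Proof.
move=> C; have [H ->] := class_of_surj C.
by apply/subclass_leP; exists 1; rewrite conjsg1.
Qed.

Lemma subclass_le_anti : antisymmetric subclass_le.
Proof.
move=> C D; have [K ->] := class_of_surj C; have [H ->] := class_of_surj D.
case/andP=> /subclass_leP[g sKH] /subclass_leP[h sHK].
apply/eqP/class_of_eqP; exists g; apply/val_inj/eqP => /=.
by rewrite eq_sym eqEcard sKH cardJg -(cardJg H h) subset_leq_card.
Qed.

Lemma subclass_le_trans : transitive subclass_le.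
Proof.
move=> D C E; have [K ->] := class_of_surj C; have [H ->] := class_of_surj D.
have [L ->] := class_of_surj E => /subclass_leP[g sKH] /subclass_leP[h sHL].
apply/subclass_leP; exists (g * h); rewrite conjsgM.
by apply: subset_trans sHL; rewrite conjSg.
Qed.

End SubgroupClasses.

Fact subclass_display : Order.disp_t. Proof. exact: Order.Disp tt tt. Qed.

HB.instance Definition _ (gT : finGroupType) :=
  Order.Le_isPOrder.Build subclass_display (subclass gT)
    (@subclass_le_refl gT) (@subclass_le_anti gT) (@subclass_le_trans gT).

Section CategoricalTransferSystems.

Variables (d : Order.disp_t) (P : porderType d).

Definition maximal_lower_bound (x z w : P) : Prop :=
  [/\ (w <= x)%O, (w <= z)%O
    & forall v : P, (v <= x)%O -> (v <= z)%O -> (w <= v)%O -> v = w].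

Record categorical_transfer_system (R : P -> P -> Prop) : Prop := {
  cts_refine : forall x y, R x y -> (x <= y)%O;
  cts_refl : forall x, R x x;
  cts_anti : forall x y, R x y -> R y x -> x = y;
  cts_trans : forall x y z, R x y -> R y z -> R x z;
  cts_restr : forall x y z w,
    R x y -> (z <= y)%O -> maximal_lower_bound x z w -> R w z
}.

End CategoricalTransferSystems.

Section Lifting.

Variable gT : finGroupType.

Record transfer_system (R : {group gT} -> {group gT} -> Prop) : Prop := {
  ts_refine : forall K H, R K H -> K \subset H;
  ts_refl : forall H, R H H;
  ts_trans : forall K H L, R K H -> R H L -> R K L;
  ts_conj : forall K H (g : gT), R K H -> R (K :^ g)%G (H :^ g)%G;
  ts_restr : forall K H L : {group gT},
    R K H -> L \subset H -> R (K :&: L)%G L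
}.

Implicit Types (R : subclass gT -> subclass gT -> Prop).
Implicit Types (S : {group gT} -> {group gT} -> Prop).

Definition pi_inv R (K H : {group gT}) : Prop :=
  K \subset H /\ R (class_of K) (class_of H).

Definition pi_upper_star R (K H : {group gT}) : Prop :=
  forall S, transfer_system S ->
    (forall K' H', pi_inv R K' H' -> S K' H') -> S K H.

Lemma pi_upper_star_smallest R :
  [/\ transfer_system (pi_upper_star R),
      forall K H, pi_inv R K H -> pi_upper_star R K H
    & forall S, transfer_system S -> (forall K H, pi_inv R K H -> S K H) ->
        forall K H, pi_upper_star R K H -> S K H].
Proof.
split=> [|K H RKH S _ sRS|S tsS sRS K H]; [split | exact: sRS | exact].
- have incl : transfer_system (fun K H : {group gT} => K \subset H).
    split=> // [A B C | A B g | A B C _ _]; first exact: subset_trans.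
      by rewrite conjSg.
    exact: subsetIr.
  by move=> K H RKH; apply: (RKH _ incl) => K' H' [].
- by move=> H S tsS _; apply: ts_refl.
- move=> K H L RKH RHL S tsS sRS.
  by apply: (ts_trans tsS) (RKH S tsS sRS) (RHL S tsS sRS).
- by move=> K H g RKH S tsS sRS; apply: (ts_conj tsS); apply: RKH.
- move=> K H L RKH sLH S tsS sRS.
  by apply: (ts_restr tsS) sLH; apply: RKH.
Qed.

Definition pi_lower_star S (C D : subclass gT) : Prop :=
  exists K H : {group gT},
    [/\ K \subset H, class_of K = C, class_of H = D & S K H].

Definition liftable R : Prop :=
  forall C D, R C D <-> pi_lower_star (pi_upper_star R) C D.

End Lifting.

(* Main.v *)
Require Import Defs.
From mathcomp Require Import all_boot all_order all_fingroup all_solvable.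

Set Implicit Arguments.
Unset Strict Implicit.
Unset Printing Implicit Defensive.

Import Order.TTheory.
Local Open Scope group_scope.

(** Write G for the ambient group. Every subgroup of the cyclic kernel N is
    normal in G, commutators lie in N because G / N is cyclic, and an element
    outside N commutes with no nontrivial element of N. From these facts one
    reads off which restrictions of a pair K <= H to L <= H are forced by the
    categorical axiom, i.e. when [K :&: L] is a maximal lower bound of [K] and
    [L]. Since an order count bounds every common lower bound as soon as K :&: L
    has the same image in G / N as the two images meet in
    ([meet_maximal_lower_bound]), this happens in three cases: when K <= N,
    when K and H have the same trace on N, and when K :&: L contains some t
    outside N, for then K and L are generated by their traces on N together with
    centralizers of t, and 'C[t] meets N trivially.

    The only restrictions the axiom may fail to force are therefore those where
    K :&: N differs from H :&: N while K :&: L lies in N; then K :&: L is the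
    restriction of K :&: N to L. If the pair ([K :&: N], [H]) is in R, this is
    the first case, so [pi_inv R] is already a transfer system
    ([pi_inv_transfer_system]), hence equals [pi_upper_star R], and R is
    liftable. Conversely, when K :&: N differs from H :&: N, conjugating K by
    some h in H :&: N outside K gives K :&: K :^ h = K :&: N; restricting K to
    K :^ h, which is related to H :^ h = H, forces [pi_upper_star R] to relate
    K :&: N to H ([pi_upper_star_kernel]). *)

(** * Conjugacy classes of subgroups *)

Section Classes.

Variable gT : finGroupType.
Implicit Types (K H : {group gT}).

Lemma class_of_conj K g : class_of (K :^ g)%G = class_of K.
Proof. by apply/esym/eqP/class_of_eqP; exists g. Qed.

Lemma class_of_le K H : K \subset H -> (class_of K <= class_of H)%O.
Proof. by move=> sKH; apply/subclass_leP; exists 1; rewrite conjsg1. Qed.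

End Classes.

(** * Commutators with elements outside the kernel *)

Section Kernel.

Variables (gT : finGroupType) (N : {group gT}).
Hypothesis metaN : metacyclic_Frobenius [set: gT]%G N.
Implicit Types (A H K L V : {group gT}) (g h k n t x y : gT).

(** Subgroups of a cyclic group are characteristic, and N is normal. *)
Lemma conj_sub_kernel A g : A \subset N -> A :^ g = A.
Proof.
move=> sAN; have /existsP[T /and3P[frobG cycN _]] := metaN.
have [/sdprod_context[nsNG _ _ _ _] _ _ _ _] := Frobenius_context frobG.
have charA: A \char N by rewrite sub_cyclic_char.
have /normalP[_ nAG] := char_normal_trans charA nsNG.
by apply: nAG; rewrite inE.
Qed.

(** The quotient by N is isomorphic to the cyclic complement. *)
Lemma commg_in_kernel x y : [~ x, y] \in N.
Proof.
have /existsP[T /and3P[frobG _ cycT]] := metaN.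
have [defG _ _ _ _] := Frobenius_context frobG.
have [/andP[_ nNG] _ _ _ _] := sdprod_context defG.
have abq: abelian ([set: gT] / N).
  by rewrite -(isog_abelian (sdprod_isog defG)) cyclic_abelian.
by apply: (subsetP (der1_min nNG abq)); rewrite mem_commg ?inE.
Qed.

(** In a Frobenius group the centralizer of n != 1 in N is contained in N. *)
Lemma kernel_commute_eq1 t n : t \notin N -> n \in N -> commute t n -> n = 1.
Proof.
move=> ntN nN ctn; have /existsP[T /and3P[frobG _ _]] := metaN.
apply/eqP; apply: contraNT ntN => nt_n.
apply: (subsetP (Frobenius_cent1_ker frobG (x := n) _)).
  by rewrite !inE nt_n.
by apply/setIP; split; [rewrite inE | apply/cent1P].
Qed.

Lemma commg_eq_commute t k x : [~ t, k] = [~ t, x] -> commute t (k * x^-1).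
Proof. by move/mulgI=> e; apply/commgP/conjg_fixP; rewrite conjgM e conjgK. Qed.

(** The map x |-> [~ t, x] sends K :&: N into itself and is injective because t
    centralizes no nontrivial element of N; by finiteness it is onto. This stands
    in for the conjugacy of complements of K :&: N in K. *)
Lemma kernel_commg_onto K t y :
  t \in K -> t \notin N -> y \in K :&: N ->
  exists2 x, x \in K :&: N & y = [~ t, x].
Proof.
move=> Kt ntN KNy; pose f x := [~ t, x].
(* Values agree at x and x' iff t commutes with x * x'^-1, which lies in N. *)
have injf: {in K :&: N &, injective f}.
  move=> x x' /setIP[_ Nx] /setIP[_ Nx'] /commg_eq_commute ctxx'.
  suff /eqP: x * x'^-1 = 1 by rewrite -eq_mulgV1 => /eqP.
  by apply: (kernel_commute_eq1 ntN) => //; rewrite groupM ?groupV.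
have sfKN: f @: (K :&: N) \subset K :&: N.
  apply/subsetP=> _ /imsetP[x /setIP[Kx _] ->].
  by rewrite inE groupR ?commg_in_kernel.
have /eqP eq_f: f @: (K :&: N) == K :&: N.
  by rewrite eqEcard sfKN (card_in_imset injf) /=.
by move: KNy; rewrite -{1}eq_f => /imsetP[x KNx ->]; exists x.
Qed.

(** If [~ t, n] lies in K it equals [~ t, x] for some x in K :&: N, and then
    n = x. Hence the normalizer of K in N is K :&: N unless K <= N. *)
Lemma conj_in_kernel_mem K t n :
  t \in K -> t \notin N -> n \in N -> t ^ n \in K -> n \in K.
Proof.
move=> Kt ntN Nn Ktn.
have KNtn: [~ t, n] \in K :&: N.
  by rewrite inE commg_in_kernel andbT groupM ?groupV.
have [x /setIP[Kx Nx] /commg_eq_commute ctnx] := kernel_commg_onto Kt ntN KNtn.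
have /eqP: n * x^-1 = 1.
  by apply: (kernel_commute_eq1 ntN) => //; rewrite groupM ?groupV.
by rewrite -eq_mulgV1 => /eqP->.
Qed.

(** Thus K is the product of 'C_K[t] and K :&: N: the centralizer of t
    is a complement of the kernel part, chosen the same way for every K
    containing t. *)
Lemma commuting_representative K t k :
  t \in K -> t \notin N -> k \in K ->
  exists2 x, x \in K :&: N & commute t (k * x^-1).
Proof.
move=> Kt ntN Kk.
have KNtk: [~ t, k] \in K :&: N by rewrite inE commg_in_kernel groupR.
have [x KNx /commg_eq_commute ctkx] := kernel_commg_onto Kt ntN KNtk.
by exists x.
Qed.

(** * Meets that give maximal lower bounds *)

(** Conjugation disappears both on N and modulo N, so a subconjugate of K
    is controlled by K itself in these two places. *)
Lemma conj_sub_mul_kernel V K g :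
  V :^ g \subset K -> V \subset K * N /\ V :&: N \subset K.
Proof.
move=> sVK; split.
  apply/subsetP=> v Vv; apply/mulsgP; exists (v ^ g) ([~ v, g]^-1).
  - by rewrite (subsetP sVK) ?memJ_conjg.
  - by rewrite groupV commg_in_kernel.
  - by rewrite commgEl invMg invgK mulgA mulgV mul1g.
rewrite -(conj_sub_kernel g (subsetIr V N)); apply: subset_trans sVK.
by rewrite conjSg subsetIl.
Qed.

(** For a common lower bound [V], both V * N and V :&: N are contained in the
    same expressions for K :&: L, so V has at most the order of K :&: L; if in
    addition a conjugate of K :&: L is contained in V, it equals V. *)
Lemma meet_maximal_lower_bound K L :
  K * N :&: L * N \subset (K :&: L) * N ->
  maximal_lower_bound (class_of K) (class_of L) (class_of (K :&: L)%G).
Proof.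
move=> sKLN; split.
- by apply/subclass_leP; exists 1; rewrite conjsg1 subsetIl.
- by apply/subclass_leP; exists 1; rewrite conjsg1 subsetIr.
move=> C; have [V ->] := class_of_surj C.
move=> /subclass_leP[g /conj_sub_mul_kernel[sVKN sVNK]].
move=> /subclass_leP[h /conj_sub_mul_kernel[sVLN sVNL]] /subclass_leP[z sKLV].
apply/esym/eqP/class_of_eqP; exists z; apply/val_inj/eqP => /=.
(* #|V| * #|N| = #|V * N| * #|V :&: N|, and likewise for K :&: L. *)
rewrite eq_sym eqEcard sKLV cardJg /= -(leq_pmul2r (cardG_gt0 N)).
rewrite !mul_cardG leq_mul ?subset_leq_card //=; last first.
  by rewrite subsetI subsetIr andbT subsetI sVNK.
rewrite -{2}(mulGid N) mulgA mulSg //.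
by apply: subset_trans sKLN; rewrite subsetI sVKN.
Qed.

Lemma kernel_meet_maximal_lower_bound K L : K \subset N ->
  maximal_lower_bound (class_of K) (class_of L) (class_of (K :&: L)%G).
Proof.
move=> sKN; apply: meet_maximal_lower_bound.
apply: subset_trans (subsetIl _ _) _.
by rewrite (mulSGid sKN) mulG_subr.
Qed.

(** An element of L in the coset k N differs from k by an element of H :&: N,
    which is contained in K, so it lies in K as well. *)
Lemma same_kernel_meet_maximal_lower_bound H K L :
  K \subset H -> L \subset H -> K :&: N = H :&: N ->
  maximal_lower_bound (class_of K) (class_of L) (class_of (K :&: L)%G).
Proof.
move=> sKH sLH eqN; apply: meet_maximal_lower_bound.
apply/subsetP=> _ /setIP[/mulsgP[k n Kk Nn ->] /mulsgP[l m Ll Nm eq_kl]].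
have def_l: l = k * (n * m^-1) by rewrite mulgA eq_kl mulgK.
rewrite eq_kl mem_mulg // inE Ll andbT.
suff: n * m^-1 \in K :&: N by rewrite def_l => /setIP[Knm _]; rewrite groupM.
rewrite eqN inE andbC groupM ?groupV //=.
have ->: n * m^-1 = k^-1 * l by rewrite def_l mulKg.
by rewrite groupM ?groupV ?(subsetP sKH k) ?(subsetP sLH).
Qed.

(** A coset of N meeting both K and L contains an element of K and an element
    of L commuting with t; their quotient is in N and commutes with t, so they
    coincide. *)
Lemma nonkernel_meet_maximal_lower_bound K L t :
  t \in K :&: L -> t \notin N ->
  maximal_lower_bound (class_of K) (class_of L) (class_of (K :&: L)%G).
Proof.
move=> /setIP[Kt Lt] ntN; apply: meet_maximal_lower_bound.
apply/subsetP=> _ /setIP[/mulsgP[k n Kk Nn ->] /mulsgP[l m Ll Nm eq_kl]].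
have [x /setIP[Kx Nx] ctkx] := commuting_representative Kt ntN Kk.
have [y /setIP[Ly Ny] ctly] := commuting_representative Lt ntN Ll.
have eq_kxly: (k * x^-1)^-1 * (l * y^-1) = 1.
  apply: (kernel_commute_eq1 ntN); last by apply: commuteM => //; apply: commuteV.
  have ->: l = k * n * m^-1 by rewrite eq_kl mulgK.
  by rewrite invMg invgK !mulgA mulgKV !groupM ?groupV.
have {}eq_kxly: k * x^-1 = l * y^-1.
  by move/eqP: eq_kxly; rewrite -eq_mulVg1 => /eqP.
apply/mulsgP; exists (k * x^-1) (x * n).
- by rewrite inE {2}eq_kxly !groupM ?groupV.
- by rewrite groupM.
- by rewrite mulgA mulgKV.
Qed.

(** * Transfer systems *)

Lemma pi_inv_transfer_system (R : subclass gT -> subclass gT -> Prop) :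
  categorical_transfer_system R ->
  (forall K H, R (class_of K) (class_of H) -> K :&: N <> H :&: N ->
     R (class_of (K :&: N)%G) (class_of H)) ->
  transfer_system (pi_inv R).
Proof.
move=> ctsR kerR; split.
- by move=> K H [].
- by move=> H; split=> //; apply: cts_refl.
- move=> K H L [sKH RKH] [sHL RHL].
  by split; [apply: subset_trans sHL | apply: (cts_trans ctsR) RHL].
- move=> K H g [sKH RKH]; split; first by rewrite conjSg.
  by rewrite !class_of_conj.
move=> K H L [sKH RKH] sLH; split; first exact: subsetIr.
have leLH := class_of_le sLH.
have [sKLN | /subsetPn[t KLt ntN]] := boolP (K :&: L \subset N); last first.
  exact: (cts_restr ctsR RKH leLH (nonkernel_meet_maximal_lower_bound KLt ntN)).
have [eqN | /eqP neqN] := eqVneq (K :&: N) (H :&: N).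
  apply: (cts_restr ctsR RKH leLH).
  exact: same_kernel_meet_maximal_lower_bound sKH sLH eqN.
(* K :&: L <= N, so it is also the restriction of K :&: N to L. *)
have -> : (K :&: L)%G = (K :&: N :&: L)%G.
  by apply/val_inj; rewrite /= setIAC; apply/esym/setIidPl.
apply: (cts_restr ctsR (kerR K H RKH neqN) leLH).
exact: kernel_meet_maximal_lower_bound (subsetIr K N).
Qed.

(** If t in K :&: K :^ h were outside N, its conjugate by h^-1 would also be in
    K, which forces h in K by [conj_in_kernel_mem]. *)
Lemma conj_meet_kernel K h :
  h \in N -> h \notin K -> K :&: K :^ h = K :&: N.
Proof.
move=> Nh nKh; apply/eqP; rewrite eqEsubset; apply/andP; split.
  rewrite subsetI subsetIl /=; apply/subsetP=> t /setIP[Kt].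
  rewrite mem_conjg => Kth; apply: contraR nKh => ntN.
  by rewrite -groupV; apply: conj_in_kernel_mem Kt ntN _ Kth; rewrite groupV.
rewrite subsetI subsetIl -(conj_sub_kernel h (subsetIr K N)).
by rewrite conjSg subsetIl.
Qed.

(** Choose h in H :&: N outside K. The pair (K :^ h, H) is a conjugate of (K, H),
    and restricting (K, H) to K :^ h gives (K :&: N, K :^ h). *)
Lemma pi_upper_star_kernel (R : subclass gT -> subclass gT -> Prop) K H :
  K \subset H -> R (class_of K) (class_of H) -> K :&: N <> H :&: N ->
  pi_upper_star R (K :&: N)%G H.
Proof.
move=> sKH RKH neqN.
have [tsS sRS _] := pi_upper_star_smallest R.
have SKH : pi_upper_star R K H by apply: sRS.
have /subsetPn[h HNh nKNh] : ~~ (H :&: N \subset K :&: N).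
  by apply/negP=> sHK; apply: neqN; apply/eqP; rewrite eqEsubset sHK setSI.
have [Hh Nh] := setIP HNh.
have nKh : h \notin K by apply: contra nKNh => Kh; rewrite inE Kh.
have defH : (H :^ h)%G = H by apply/val_inj; rewrite /= conjGid.
have SKhH : pi_upper_star R (K :^ h)%G H by rewrite -defH; apply: (ts_conj tsS).
have -> : (K :&: N)%G = (K :&: K :^ h)%G.
  by apply/val_inj; rewrite /= (conj_meet_kernel Nh nKh).
have sKhH := ts_refine tsS SKhH.
exact: (ts_trans tsS (ts_restr tsS SKH sKhH) SKhH).
Qed.

End Kernel.

(** Then [pi_upper_star R] is [pi_inv R], whose image on classes is R. *)
Lemma liftable_of_transfer_system (gT : finGroupType)
    (R : subclass gT -> subclass gT -> Prop) :
  categorical_transfer_system R -> transfer_system (pi_inv R) -> liftable R.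
Proof.
move=> ctsR tsR C D; split=> [RCD | [K [H [_ <- <- SKH]]]]; last first.
  by have [] := SKH _ tsR (fun _ _ => id).
have [K defC] := class_of_surj C; have [H defD] := class_of_surj D.
rewrite defC defD in RCD *.
have /subclass_leP[g sKH] := cts_refine ctsR RCD.
exists (K :^ g)%G, H; split=> //; first exact: class_of_conj.
by move=> S _; apply; split; rewrite // class_of_conj.
Qed.

Theorem corollary3p12 (gT : finGroupType) (N : {group gT})
    (metaN : metacyclic_Frobenius [set: gT]%G N)
    (R : subclass gT -> subclass gT -> Prop)
    (ctsR : categorical_transfer_system R) :
  (liftable R <->
    (forall K H : {group gT},
       R (class_of K) (class_of H) -> (K :&: N)%g <> (H :&: N)%g ->
       R (class_of (K :&: N)%G) (class_of H)))
  /\ (forall K H : {group gT},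
       R (class_of K) (class_of H) -> (K :&: N)%g <> (H :&: N)%g ->
       (R (class_of (K :&: N)%G) (class_of H)
        <-> R (class_of (K :&: N)%G) (class_of K))).
Proof.
split; last first.
  move=> K H RKH _; split=> [RKNH | RKNK]; last exact: (cts_trans ctsR) RKH.
  apply: (cts_restr ctsR RKNH (cts_refine ctsR RKH)).
  have {2}-> : (K :&: N)%G = (K :&: N :&: K)%G.
    by apply/val_inj; rewrite /= setIAC setIid.
  exact: (kernel_meet_maximal_lower_bound metaN) (subsetIr K N).
split=> [liftR K H RKH neqN | kerR]; last first.
  exact: liftable_of_transfer_system (pi_inv_transfer_system metaN ctsR kerR).
(* Replace K by a conjugate inside H; the trace on N does not change. *)
have /subclass_leP[g sKH] := cts_refine ctsR RKH.
have eqKN : K :^ g :&: N = K :&: N.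
  by rewrite -{1}(conj_sub_kernel metaN g (subxx N)) -conjIg
    (conj_sub_kernel metaN) ?subsetIr.
apply/liftR; exists (K :&: N)%G, H; split=> //.
  by rewrite /= -eqKN; apply: subset_trans (subsetIl _ _) sKH.
have -> : (K :&: N)%G = (K :^ g :&: N)%G by apply/val_inj.
by apply: pi_upper_star_kernel; rewrite ?class_of_conj ?eqKN.
Qed.
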